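(* For $\tau>2$, let $p_k=k^{-\tau}/\zeta(\tau)$, $k\in\mathbb N=\{1,2,\ldots\}$, with $\zeta$ the Riemann zeta function, and let $\mu$ be the law of the friendship bias $\Delta_\phi$ of the root of the unimodular branching process tree with root offspring distribution $(p_k)_{k\in\mathbb N}$ (the local limit of the configuration model whose limiting degree distribution is $(p_k)$). Then $\mu([0,\infty))>\frac12$ for all $\tau>2$. In addition, $\lim_{\tau\downarrow2}\mu([0,\infty))=1$ and $\lim_{\tau\to\infty}\mu([0,\infty))=1$.
   Context: Let $D$ be a random variable with $\mathbb P\{D=k\}=p_k$. In the unimodular branching process tree with root offspring distribution $p=(p_k)$, the root $\phi$ has $d_\phi$ children with $\mathbb P\{d_\phi=k\}=p_k$, and every other vertex independently has a number of children distributed according to $p^\star_k=(k+1)p_{k+1}/\mathbb E[D]$, $k\in\mathbb N_0$. So $d_\phi$ and the numbers $d_1,d_2,\ldots$ of children of the children of the root are independent, $d_\phi\sim p$, and $d_j\sim p^\star$ for all $j$. The friendship bias of the root is $\Delta_\phi=\frac1{d_\phi}\sum_{j=1}^{d_\phi}(d_j+1)-d_\phi$ (note $d_\phi\ge1$), and $\mu$ (depending on $\tau$) is its law. *)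

(* Defs.v *)
From HB Require Import structures.
From mathcomp Require Import all_boot all_order all_algebra.
From mathcomp Require Import all_classical all_reals all_analysis.
From mathcomp Require Import measurable_realfun.

Set Implicit Arguments.
Unset Strict Implicit.
Unset Printing Implicit Defensive.

Import Order.TTheory GRing.Theory Num.Theory.
Import numFieldNormedType.Exports.

Local Open Scope classical_set_scope.
Local Open Scope ring_scope.

(* Only meaningful for s > 1: otherwise the series diverges and [limn] returns
   an unspecified value. *)
Definition zeta (R : realType) (s : R) : R :=
  limn (series (fun k : nat => k.+1%:R `^ (- s))).

Definition power_law (R : realType) (tau : R) (k : nat) : R :=
  if k == 0%N then 0 else k%:R `^ (- tau) / zeta tau.

Definition mean (R : realType) (p : nat -> R) : R :=
  limn (series (fun k : nat => k%:R * p k)).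

Definition star (R : realType) (p : nat -> R) (k : nat) : R :=
  k.+1%:R * p k.+1 / mean p.

Definition mutual_independence (R : realType) (d d' : measure_display)
    (T : measurableType d) (T' : measurableType d') (P : probability T R)
    (I : eqType) (X : I -> {RV P >-> T'}) : Prop :=
  forall (J : seq I) (A : I -> set T'), uniq J ->
    (forall i, measurable (A i)) ->
    P (\bigcap_(i in [set` J]) (X i @^-1` A i)) =
    (\prod_(i <- J) P (X i @^-1` A i))%E.

(* Ulam-Harris labelling: the root is [::] and the j-th child (from 0) of a
   vertex u is rcons u j. [N u] is the number of children of u; it is given for
   every label u, and the tree consists of the labels all of whose prefixes
   rcons v j satisfy j < N v. *)
Definition unimodular_branching_tree (R : realType) (d : measure_display)
    (T : measurableType d) (P : probability T R) (p : nat -> R)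
    (N : seq nat -> {RV P >-> nat}) : Prop :=
  [/\ mutual_independence N,
      forall k : nat, distribution P (N [::]) [set k] = (p k)%:E &
      forall (u : seq nat) (k : nat), u != [::] ->
        distribution P (N u) [set k] = (star p k)%:E].

(* A child of the root has degree 1 + (its number of children), the root has
   degree N [::]. When N [::] w = 0 the quotient is 0 by convention; this is a
   null event as soon as p 0 = 0. *)
Definition friendship_bias (R : realType) (d : measure_display)
    (T : measurableType d) (N : seq nat -> {mfun T >-> nat}) (w : T) : R :=
  (\sum_(j < N [::] w) (N [:: nat_of_ord j] w + 1)%:R) / (N [::] w)%:R
  - (N [::] w)%:R.

Lemma measurable_friendship_bias (R : realType) (d : measure_display)
    (T : measurableType d) (N : seq nat -> {mfun T >-> nat}) :
  measurable_fun [set: T] (friendship_bias R N).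
Proof.
pose g (k : nat) (w : T) : R :=
  (\sum_(j < k) (N [:: nat_of_ord j] w + 1)%:R) / k%:R - k%:R.
have mg k : measurable_fun [set: T] (g k).
  apply: measurable_funB => //; apply: measurable_funM => //.
  apply: measurable_sum => j.
  apply: (@measurableT_comp _ _ _ _ _ _ (fun n : nat => (n + 1)%:R : R)) => //.
move=> _ A mA; rewrite setTI.
have -> : friendship_bias R N @^-1` A =
    \bigcup_k (N [::] @^-1` [set k] `&` g k @^-1` A).
  apply/seteqP; split=> [w Aw|w [k _ [/= Nk gA]]].
    by exists (N [::] w).
  by rewrite /= /friendship_bias Nk.
apply: bigcup_measurable => k _; apply: measurableI.
  by rewrite -[X in measurable X]setTI; exact: measurable_funPT.
by rewrite -[X in measurable X]setTI; exact: mg.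
Qed.

HB.instance Definition _ (R : realType) (d : measure_display)
    (T : measurableType d) (N : seq nat -> {mfun T >-> nat}) :=
  isMeasurableFun.Build _ _ _ _ (friendship_bias R N)
    (@measurable_friendship_bias R d T N).

(* Main.v *)
Require Import Defs.
From mathcomp Require Import all_boot all_order all_algebra.
From mathcomp Require Import all_classical all_reals all_analysis.
From mathcomp Require Import measurable_realfun lra.
Import Order.TTheory GRing.Theory Num.Theory.
Import numFieldNormedType.Exports.
Local Open Scope classical_set_scope.
Local Open Scope ring_scope.

(** Write x for mu([0, oo)), D for the root degree and d_1 for the number of
    children of the first child. The bias is nonnegative as soon as
    1 <= D <= K and d_1 + 1 >= K^2, so a union bound gives, for every K >= 1,
      1 <= x + P(D > K) + P(d_1 < K^2 - 1).
    Comparison with a telescoping series gives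
      P(D > K) <= p_1 (K+1)^(2 - tau) / K.
    For K = 1 the last probability vanishes and p_1 <= x, so that
    1 <= x (1 + 2^(2 - tau)): this yields both x > 1/2 and the limit at oo.
    For tau -> 2+, take K large; since p*_k = p*_0 (k+1)^(1 - tau) has total
    mass at most 1 and the harmonic series diverges, p*_0 tends to 0, hence so
    does P(d_1 < K^2 - 1) <= (K^2 - 1) p*_0.
    Only the ratios p_k / p_1 and p*_k / p*_0 enter; the normalisation comes
    from the total mass, never from the limits defining zeta and the mean. *)

(** * Power sums and ratios of the power law *)

Lemma sum_powR_tail_le {R : realType} {tau : R} (K n : nat) :
  2 <= tau -> (0 < K)%N ->
  \sum_(K <= k < n) k.+1%:R `^ (- tau) <= K.+1%:R `^ (2 - tau) / K%:R.
Proof.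
move=> tau2 K0; have b0 : 0 <= K.+1%:R `^ (2 - tau) :> R by exact: powR_ge0.
have [nK|Kn] := leqP n K.
  by rewrite big_geq// divr_ge0.
(* Split off the square: the factor with exponent 2 - tau <= 0 is largest at k = K, and (k+1)^(-2)
   <= 1/k - 1/(k+1), which telescopes. *)
have le_term k : (K <= k < n)%N -> k.+1%:R `^ (- tau) <=
    K.+1%:R `^ (2 - tau) * (- k.+1%:R^-1 - - k%:R^-1) :> R.
  move=> /andP[Kk _]; have k0 : (0 < k)%N by exact: leq_trans Kk.
  have -> : k.+1%:R `^ (- tau) = k.+1%:R `^ (2 - tau) * k.+1%:R ^- 2 :> R.
    rewrite -powR_invn// -powRD ?pnatr_eq0 ?implybT//.
    by rewrite addrAC subrr add0r.
  apply: ler_pM => //; rewrite ?powR_ge0 ?invr_ge0 ?exprn_ge0//.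
    rewrite -opprB !powRN lef_pV2 ?posrE ?powR_gt0//.
    by rewrite ge0_ler_powR ?subr_ge0 ?nnegrE ?ler_nat ?ltnS.
  rewrite opprK addrC -[k%:R^-1]mul1r -[k.+1%:R^-1]mul1r.
  rewrite -mulNr addf_div ?pnatr_eq0 -?lt0n// !mul1r mulN1r.
  rewrite -natr1 addrAC subrr add0r.
  rewrite mul1r lef_pV2 ?posrE ?exprn_gt0 ?mulr_gt0 ?ltr0n// ?addr_gt0 ?ltr0n//.
  by rewrite natr1 expr2 ler_pM2r ?ler_nat ?ltr0n.
apply: le_trans (ler_sum_nat le_term) _.
rewrite -mulr_sumr telescope_sumr 1?ltnW// opprK ler_wpM2l//.
by rewrite gerDr oppr_le0 invr_ge0.
Qed.

Lemma power_lawS {R : realType} (tau : R) (k : nat) :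
  power_law tau k.+1 = power_law tau 1 * k.+1%:R `^ (- tau).
Proof. by rewrite /power_law/= powR1 mul1r mulrC. Qed.

Lemma star_power_law {R : realType} (tau : R) (k : nat) :
  star (power_law tau) k = star (power_law tau) 0 * k.+1%:R `^ (1 - tau).
Proof.
rewrite /star power_lawS mul1r.
have -> : k.+1%:R `^ (1 - tau) = k.+1%:R * k.+1%:R `^ (- tau) :> R.
  by rewrite powRD ?powRr1// pnatr_eq0 implybT.
by rewrite [RHS]mulrAC mulrCA.
Qed.

(** * Laws on the natural numbers given by their point masses *)

Lemma prob_nat_pmf_ge0 {R : realType}
    {mu : probability nat R} {q : nat -> R} (k : nat) :
  (forall k, mu [set k] = (q k)%:E) -> 0 <= q k.
Proof. by move=> muq; rewrite -lee_fin -muq. Qed.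

Lemma prob_nat_partial_sum_le1 {R : realType}
    {mu : probability nat R} {q : nat -> R} (n : nat) :
  (forall k, mu [set k] = (q k)%:E) -> \sum_(k < n) q k <= 1.
Proof.
move=> muq; rewrite -lee_fin -sumEFin.
under eq_bigr do rewrite -muq.
rewrite -(@measure_semi_additive_ord_I _ _ _ mu (fun k => [set k]))
  ?probability_le1//.
by move=> i j _ _ [x [/= -> ->]].
Qed.

Lemma prob_nat_ltn_le {R : realType}
    {mu : probability nat R} {q : nat -> R} (b : R) (n : nat) :
  (forall k, mu [set k] = (q k)%:E) -> (forall k, q k <= b) ->
  (mu [set k | (k < n)%N] <= (n%:R * b)%:E)%E.
Proof.
move=> muq qb.
apply: (@le_trans _ _ (\sum_(k < n) mu [set nat_of_ord k])%E).
  apply: (@content_subadditive _ _ _ mu _ (fun k => [set k])) => //.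
  by move=> k/= kn; rewrite -(bigcup_mkord n (fun k => [set k])); exists k.
rewrite (eq_bigr (fun k : 'I_n => (q k)%:E)) ?sumEFin ?lee_fin//.
apply: (le_trans (ler_sum _ (fun (k : 'I_n) _ => qb k))).
by rewrite sumr_const card_ord mulr_natl.
Qed.

Lemma power_law_gtn_le {R : realType} (tau : R) (mu : probability nat R)
    (K : nat) :
  2 <= tau -> (0 < K)%N ->
  (forall k, mu [set k] = (power_law tau k)%:E) ->
  (mu [set k | (K < k)%N] <=
    (power_law tau 1 * (K.+1%:R `^ (2 - tau) / K%:R))%:E)%E.
Proof.
move=> tau2 K0 muq.
apply: (le_trans (@measure_sigma_subadditive_tail _ _ _ mu _
  (fun k => [set k]) K.+1 _ _ _)) => //.
  by move=> k/= Kk; exists k => //; apply/negP; rewrite -leqNgt.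
apply: lime_le; first exact: is_cvg_nneseries.
apply: nearW => n; under eq_bigr do rewrite /= muq.
(* The shift makes the sum start at K with terms in k+1, the form of [sum_powR_tail_le]. *)
rewrite sumEFin lee_fin big_add1.
under eq_bigr do rewrite power_lawS.
rewrite -mulr_sumr ler_wpM2l ?sum_powR_tail_le//.
exact: (prob_nat_pmf_ge0 _ muq).
Qed.

(** * Events forcing a nonnegative bias *)

Lemma friendship_bias_ge0 {R : realType} {d : measure_display}
    {T : measurableType d} (N : seq nat -> {mfun T >-> nat}) (w : T) (K : nat) :
  (0 < N [::] w <= K)%N -> (K ^ 2 <= (N [:: 0%N] w).+1)%N ->
  0 <= friendship_bias R N w.
Proof.
move=> /andP[N0 NK] KN; rewrite /friendship_bias.
(* Clearing the denominator leaves D^2 <= sum of the d_j + 1; the first child alone contributes at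
   least K^2 >= D^2. *)
rewrite subr_ge0 ler_pdivlMr ?ltr0n// -natrM -natr_sum ler_nat.
rewrite (bigD1 (Ordinal N0))//= addn1 (leq_trans _ (leq_addr _ _))//.
by rewrite (leq_trans _ KN)// -mulnn leq_mul.
Qed.

(** The case K = 1, where the condition on the child is automatic: with a single neighbour the bias
    is d_1 >= 0. *)
Lemma root_offspring_eq1_le {R : realType}
    {d : measure_display} {T : measurableType d}
    (P : probability T R) (N : seq nat -> {RV P >-> nat}) :
  (distribution P (N [::]) [set 1%N] <=
   distribution P (friendship_bias R N) `[0%R, +oo[)%E.
Proof.
rewrite /distribution/= /pushforward; apply: le_measure; rewrite ?inE.
- by rewrite -[X in measurable X]setTI; exact: measurable_funPT.
- by rewrite -[X in measurable X]setTI; exact: measurable_funPT.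
move=> w /= Nw; rewrite in_itv/= andbT.
by apply: (@friendship_bias_ge0 _ _ _ _ _ 1); rewrite ?Nw.
Qed.

(** No law is imposed on the root yet, so degree 0 gets its own term, which vanishes for the power
    law. *)
Lemma friendship_bias_union_bound {R : realType}
    {d : measure_display} {T : measurableType d}
    (P : probability T R) (N : seq nat -> {RV P >-> nat}) (K : nat) :
  (1 <= distribution P (friendship_bias R N) `[0%R, +oo[ +
    (distribution P (N [::]) [set 0%N] +
      (distribution P (N [::]) [set k | (K < k)%N] +
       distribution P (N [:: 0%N]) [set k | (k < (K ^ 2).-1)%N])))%E.
Proof.
have mN u (A : set nat) : measurable (N u @^-1` A).
  by rewrite -[X in measurable X]setTI; exact: measurable_funPT.
have mB : measurable (friendship_bias R N @^-1` `[0%R, +oo[).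
  by rewrite -[X in measurable X]setTI; exact: measurable_funPT.
rewrite -(@probability_setT _ _ _ P) /distribution/= /pushforward.
have mU := measurableU _ _ (mN [::] [set k | (K < k)%N])
  (mN [:: 0%N] [set k | (k < (K ^ 2).-1)%N]).
have mU' := measurableU _ _ (mN [::] [set 0%N]) mU.
apply: (le_trans _ (leeD2l _ (leeD2l _ (measureU2 P (mN _ _) (mN _ _))))).
apply: (le_trans _ (leeD2l _ (measureU2 P (mN _ _) mU))).
apply: (le_trans _ (measureU2 P mB mU')).
apply: le_measure; rewrite ?inE//; first exact: measurableU.
move=> w _ /=.
have [N0|N0] := posnP (N [::] w); first by right; left.
have [KN|NK] := ltnP K (N [::] w); first by right; right; left.
have [NK2|NK2] := ltnP (N [:: 0%N] w) (K ^ 2).-1; first by right; right; right.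
left; rewrite in_itv/= andbT.
apply: (@friendship_bias_ge0 _ _ _ _ _ K); first by rewrite N0.
by case: (K ^ 2)%N NK2.
Qed.

(** * The tree at a fixed exponent *)

Section power_law_tree.
Context {R : realType} {d : measure_display} {T : measurableType d}.
Context (P : probability T R) (N : seq nat -> {RV P >-> nat}) (tau : R).
Context (tau_ge2 : 2 <= tau)
  (treeN : unimodular_branching_tree (power_law tau) N).

Let x := fine (distribution P (friendship_bias R N) `[0%R, +oo[).
Let p1 := power_law tau 1.
Let s0 := star (power_law tau) 0.

Let root k : distribution P (N [::]) [set k] = (power_law tau k)%:E.
Proof. by case: treeN. Qed.

Let child k : distribution P (N [:: 0%N]) [set k] = (star (power_law tau) k)%:E.
Proof. by case: treeN => _ _; exact. Qed.

Let muE : distribution P (friendship_bias R N) `[0%R, +oo[ = x%:E.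
Proof. by rewrite fineK// fin_num_measure. Qed.

Lemma star_power_law0_ge0 : 0 <= s0.
Proof. exact: (prob_nat_pmf_ge0 _ child). Qed.

Lemma power_law1_le_nonneg : power_law tau 1 <= x.
Proof. by rewrite -lee_fin -muE -root root_offspring_eq1_le. Qed.

Lemma power_law_bias_union_bound (K : nat) : (0 < K)%N ->
  1 <= x + p1 * (K.+1%:R `^ (2 - tau) / K%:R) + (K ^ 2).-1%:R * s0.
Proof.
move=> K0; have := friendship_bias_union_bound P N K.
rewrite muE root {1}/power_law/= add0e -lee_fin -addrA !EFinD.
move=> /le_trans; apply.
rewrite leeD2l// leeD//; first exact: power_law_gtn_le.
(* Every p*_k is at most p*_0, because (k+1)^(1 - tau) <= 1. *)
apply: prob_nat_ltn_le child _ => k; rewrite star_power_law -[leRHS]mulr1.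
rewrite ler_wpM2l ?star_power_law0_ge0//.
rewrite -opprB powRN invf_le1 ?powR_gt0// -[leLHS](powRr0 k.+1%:R).
by rewrite ler_powR ?ler1n// subr_ge0 (le_trans _ tau_ge2)// ler1n.
Qed.

(** Keeping the sum finite allows tau to tend to 2 with n fixed, so that no limit is exchanged with
    an infinite sum. *)
Lemma star_power_law0_le (n : nat) :
  s0 * \sum_(k < n) k.+1%:R `^ (1 - tau) <= 1.
Proof.
rewrite mulr_sumr; under eq_bigr do rewrite -star_power_law.
exact: (prob_nat_partial_sum_le1 _ child).
Qed.

End power_law_tree.

(** * Limits in the exponent *)

Lemma series_harmonic_cvgy {R : realType} :
  series (@harmonic R) n @[n --> \oo] --> +oo.
Proof.
apply: nondecreasing_dvgn_lt (@dvg_harmonic R).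
by apply: nondecreasing_series => n _ _; exact: harmonic_ge0.
Qed.

Lemma sum_powR_cvg_harmonic {R : realType} (n : nat) :
  \sum_(k < n) k.+1%:R `^ (1 - tau) @[tau --> (2 : R)^'+] -->
  series (@harmonic R) n.
Proof.
apply: cvg_at_right_filter; rewrite seriesEord.
apply: cvg_big; first exact: add_continuous.
move=> k _; rewrite /= -powR_inv1//.
have -> : -1 = 1 - 2%:R :> R by lra.
rewrite /powR pnatr_eq0/=.
apply: continuous_cvg; first exact: continuous_expR.
by apply: cvgMl; apply: cvgB; [exact: cvg_cst|exact: cvg_id].
Qed.

Lemma powR2_cvg0 {R : realType} : 2 `^ (2 - tau) @[tau --> +oo] --> (0 : R).
Proof.
apply/cvgrPdist_le => e e0.
(* With 1/(n+1) < e, any t >= n + 3 works, since 2^(t - 2) >= 2^(n+1) >= n + 1. *)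
have [n ne] := ltr_add_invr e0; rewrite add0r in ne.
near=> t; rewrite sub0r normrN ger0_norm ?powR_ge0//.
apply: (le_trans _ (ltW ne)).
have -> : 2 - t = - (t - 2) by rewrite opprB.
rewrite powRN lef_pV2 ?posrE ?powR_gt0//.
apply: (@le_trans _ _ (2 `^ n.+1%:R)).
  by rewrite powR_mulrn// -natrX ler_nat ltnW// ltn_expl.
rewrite ler_powR ?ler1n// lerBrDr; near: t; exact: nbhs_pinfty_ge.
Unshelve. all: by end_near. Qed.

Lemma cvge_to1 {R : realType} (F : set_system R) (f : R -> \bar R) :
  Filter F -> (forall x, f x <= 1)%E ->
  (forall e : R, 0 < e -> \forall x \near F, ((1 - e)%:E <= f x)%E) ->
  f x @[x --> F] --> 1%E.
Proof.
move=> FF f1 fe.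
(* The lower bound with e = 1 puts f eventually in [0, 1], hence among the finite values. *)
have ffin : \forall x \near F, f x \is a fin_num.
  apply: filterS (fe 1 ltr01) => x; rewrite subrr => f0.
  by rewrite fin_real// (lt_le_trans _ f0) ?ltNyr// (le_lt_trans (f1 x)) ?ltry.
apply/fine_cvgP; split=> //; apply/cvgrPdist_le => e e0.
near=> x.
have xfin : f x \is a fin_num by near: x.
have x1 : fine (f x) <= 1 by rewrite -lee_fin fineK.
rewrite ger0_norm ?subr_ge0// lerBlDl -lerBlDr -lee_fin fineK//.
by near: x; exact: fe.
Unshelve. all: by end_near. Qed.

Theorem theorem4p7 (R : realType) (d : R -> measure_display)
    (T : forall tau : R, measurableType (d tau))
    (P : forall tau : R, probability (T tau) R)
    (N : forall tau : R, seq nat -> {RV (P tau) >-> nat})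
    (hN : forall tau : R, 2 < tau ->
      unimodular_branching_tree (power_law tau) (N tau)) :
  let mu := fun tau : R => distribution (P tau) (friendship_bias R (N tau)) in
  [/\ forall tau : R, 2 < tau -> ((1 / 2)%:E < mu tau `[0%R, +oo[%classic)%E,
      mu tau `[0%R, +oo[%classic @[tau --> 2^'+] --> 1%E &
      mu tau `[0%R, +oo[%classic @[tau --> +oo] --> 1%E].
Proof.
move=> mu; pose x tau := fine (mu tau `[0%R, +oo[%classic).
have muE tau : mu tau `[0%R, +oo[%classic = (x tau)%:E.
  by rewrite /x fineK// fin_num_measure.
have mu_le1 tau : (mu tau `[0%R, +oo[%classic <= 1)%E by exact: probability_le1.
have main tau K : 2 < tau -> (0 < K)%N ->
    1 <= x tau +
      power_law tau 1 * (K.+1%:R `^ (2 - tau) / K%:R) +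
      (K ^ 2).-1%:R * star (power_law tau) 0.
  by move=> tau2; apply: power_law_bias_union_bound; [exact: ltW|exact: hN].
have p1_le tau : 2 < tau -> power_law tau 1 <= x tau.
  by move=> tau2; apply: power_law1_le_nonneg; exact: hN.
have root tau : 2 < tau -> forall k,
    distribution (P tau) (N tau [::]) [set k] = (power_law tau k)%:E.
  by move=> /hN[].
have fine_le1 tau : x tau <= 1 by rewrite -lee_fin -muE.
have pow2_le tau : 2 < tau -> 2 `^ (2 - tau) < 1 :> R.
  move=> tau2; rewrite -[ltRHS](powRr0 2) /powR pnatr_eq0/= ltr_expR.
  by rewrite ltr_pM2r ?subr_lt0// ln_gt0// ltr1n.
have main1 tau : 2 < tau -> 1 <= x tau * (1 + 2 `^ (2 - tau)).
  move=> tau2; have := main tau 1 tau2 isT.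
  rewrite mul0r addr0 divr1 => /le_trans; apply.
  by rewrite mulrDr mulr1 lerD2l ler_wpM2r ?powR_ge0// p1_le.
split.
(* With c = 2^(2 - tau) < 1, x (1 + c) >= 1 gives x >= 1 / (1 + c) > 1/2. *)
- move=> tau tau2; rewrite muE lte_fin.
  have := main1 tau tau2; have := pow2_le tau tau2; have := fine_le1 tau.
  have := powR_ge0 2 (2 - tau); nra.
- apply: cvge_to1 => // e e0.
  (* Each error term gets e/2. The cutoff is K+1, with 1/(K+1) < e/2. Then n, chosen before tau,
     makes the harmonic sum exceed 2M/e; this persists for tau near 2 and forces M p*_0 <= e/2. *)
  have [K Ke] := ltr_add_invr (divr_gt0 e0 (ltr0n _ 2)); rewrite add0r in Ke.
  pose M : R := (K.+1 ^ 2).-1%:R.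
  have [n Hn] : exists n, M * (2 / e) < series (@harmonic R) n.
    have /cvgryPgt/(_ (M * (2 / e))) := @series_harmonic_cvgy R.
    by move=> [n _ /(_ n (leqnn n))]; exists n.
  near=> tau; have tau2 : 2 < tau by [].
  have Hs : M * (2 / e) < \sum_(k < n) k.+1%:R `^ (1 - tau).
    by near: tau; exact: (cvgr_gt _ (sum_powR_cvg_harmonic n) _ Hn).
  have s_le := star_power_law0_le _ _ _ (hN tau tau2) n.
  have p_le : power_law tau 1 * (K.+2%:R `^ (2 - tau) / K.+1%:R) <= e / 2.
    apply: le_trans (ltW Ke); rewrite -[leRHS]mul1r ler_pM//.
    + by rewrite (prob_nat_pmf_ge0 _ (root tau tau2)).
    + by rewrite (le_trans (p1_le _ tau2)).
    + rewrite ler_pdivrMr ?ltr0n// mulVf ?pnatr_eq0//.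
      by rewrite -[leRHS](powRr0 K.+2%:R) ler_powR ?ler1n// subr_le0 ltW.
  have Ms_le : M * star (power_law tau) 0 <= e / 2.
    have s_ge0 := star_power_law0_ge0 _ _ _ (hN tau tau2).
    rewrite -[leRHS]mul1r -ler_pdivrMr ?divr_gt0// invf_div.
    apply: le_trans s_le; rewrite mulrAC mulrC.
    by rewrite ler_wpM2l// ltW.
  rewrite muE lee_fin; have := main tau K.+1 tau2 isT.
  rewrite -/M; move: p_le Ms_le.
  move: (power_law tau 1 * _) (M * star _ _) (x tau).
  by move=> u v y; lra.
- apply: cvge_to1 => // e e0.
  near=> tau; have tau2 : 2 < tau by near: tau; exact: nbhs_pinfty_gt.
  have pe : 2 `^ (2 - tau) <= e.
    by near: tau; exact: (cvgr_le _ (@powR2_cvg0 R)).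
  (* From 1 <= y (1 + c) and y <= 1 follows y >= 1 - c y >= 1 - c >= 1 - e. *)
  rewrite muE lee_fin; have := main1 tau tau2; have := fine_le1 tau.
  move: (powR_ge0 2 (2 - tau)) pe; move: (2 `^ _) (x tau) => c y.
  by nra.
Unshelve. all: by end_near. Qed.
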